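(* Let $k,r,g\ge 1$ be integers and $p\in(0,1)$. Let $W$ have the negative binomial distribution $\mathrm{NB}(k,r)$ with gap $g$ between success runs, and let $Y$ have the negative binomial distribution $\mathrm{NB}_{k,r}$ of Type I (nonoverlapping runs, no gap). Put $\hat M_{(m)}=\mathbb{E}[(Y)_{m}]$ and $\hat M_m=\mathbb{E}[Y^m]$. Then for every integer $n\ge 1$ $$\mathbb{E}[(W)_n]=\sum_{i=0}^n\binom{n}{i}\hat M_{(n-i)}\,\bigl((r-1)g\bigr)_{i},\qquad \mathbb{E}[W^n]=\sum_{i=0}^n\binom{n}{i}\hat M_{n-i}\,\bigl((r-1)g\bigr)^i ,$$ and the central moments of $W$ are the same as those of $Y$: $\mathbb{E}[(W-\mathbb{E}W)^n]=\mathbb{E}[(Y-\mathbb{E}Y)^n]$.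
   Context: Consider independent Bernoulli trials, indexed $1,2,3,\dots$, each with success probability $p$. For $Y$: as soon as $k$ consecutive successes are attained, a run is counted and counting for a new run begins from scratch with the next trial; $Y$ is the index of the trial at which the $r$-th run is completed. For $W$: after a success run of length $k$ is attained, the outcomes of the subsequent $g$ trials are ignored, and the count for the next success run begins from scratch only after those $g$ trials have been completed; $W$ is the index of the trial at which the $r$-th run is completed. It is known that $\mathbb{P}(W=n)=\mathbb{P}(Y=n-(r-1)g)$ for all $n$. Notation: $(x)_n=x(x-1)\cdots(x-n+1)$ is the falling factorial, with $(x)_0=1$; and $0^0=1$. *)

(* Defs.v *)
From HB Require Import structures.
From mathcomp Require Import all_boot all_order all_algebra.
From mathcomp Require Import all_classical all_reals all_analysis.

Set Implicit Arguments.
Unset Strict Implicit.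
Unset Printing Implicit Defensive.

Import Order.TTheory GRing.Theory Num.Theory.
Import numFieldNormedType.Exports.

Local Open Scope classical_set_scope.
Local Open Scope ring_scope.
Local Open Scope ereal_scope.

(** Trials are numbered 1, 2, 3, ...; the outcome of trial [i.+1] is [x i].
    Thus trials n-k+1, ..., n are the [x i] with [n - k <= i < n]. *)

(** Trials n-k+1, ..., n are all successes and all come after trial s. *)
Definition success_run (x : nat -> bool) (k s n : nat) : Prop :=
  (s + k <= n)%N /\ forall i, (n - k <= i < n)%N -> x i.

(** If counting begins from scratch with trial s+1, then the first run of k
    consecutive successes is attained at trial n. *)
Definition first_run (x : nat -> bool) (k s n : nat) : Prop :=
  success_run x k s n /\ forall m, (m < n)%N -> ~ success_run x k s m.

(** [run_time x k g r n]: the r-th run is completed at trial n, when the g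
    trials that follow the completion of a run are ignored. *)
Inductive run_time (x : nat -> bool) (k g : nat) : nat -> nat -> Prop :=
| run_time_first n : first_run x k 0 n -> run_time x k g 1 n
| run_time_next r m n :
    run_time x k g r m -> first_run x k (m + g) n -> run_time x k g r.+1 n.

Section Trials.
Context {d : measure_display} {T : measurableType d} {R : realType}.
Variable P : probability T R.

Definition mutually_independent (X : nat -> {RV P >-> bool}) : Prop :=
  forall (J : seq nat) (B : nat -> set bool), uniq J ->
    P (\bigcap_(i in [set` J]) (X i @^-1` B i)) =
    \prod_(i <- J) P (X i @^-1` B i).

Definition bernoulli_trials (p : R) (X : nat -> {RV P >-> bool}) : Prop :=
  mutually_independent X /\ forall i, distribution P (X i) =1 bernoulli_prob p.

End Trials.

Section Laws.
Context {d : measure_display} {T : measurableType d} {R : realType}.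
Variable P : probability T R.

(** [P] need not be the space that carries the trials: only the law of [Z] is
    prescribed.  The waiting time is almost surely finite, so a variable with
    this law may be taken with values in [nat]. *)
Definition has_NB_gap_law (k r g : nat) (p : R) (Z : {RV P >-> nat}) : Prop :=
  exists (d' : measure_display) (T' : measurableType d')
         (Q : probability T' R) (X : nat -> {RV Q >-> bool}),
    bernoulli_trials p X /\
    forall n, P [set w | Z w = n] = Q [set w | run_time (X ^~ w) k g r n].

(** Type I (nonoverlapping runs, counting resumes with the next trial): no
    trial is ignored. *)
Definition has_NB_typeI_law (k r : nat) (p : R) (Z : {RV P >-> nat}) : Prop :=
  has_NB_gap_law k r 0 p Z.

(** [(Z w) ^_ m] is computed in [nat]; for m > Z w the product contains the
    factor 0, in agreement with the falling factorial of a real number. *)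
Definition factorial_moment (Z : {RV P >-> nat}) (m : nat) : \bar R :=
  'E_P[fun w => ((Z w ^_ m)%N%:R)%R].

Definition raw_moment (Z : {RV P >-> nat}) (m : nat) : \bar R :=
  'E_P[fun w => ((Z w)%:R ^+ m)%R].

Definition central_moment (Z : {RV P >-> nat}) (m : nat) : \bar R :=
  'E_P[fun w => (((Z w)%:R - fine 'E_P[fun w' => (Z w')%:R%R]) ^+ m)%R].

Definition finite_moment (Z : {RV P >-> nat}) (m : nat) : Prop :=
  P.-integrable setT (fun w => ((Z w)%:R ^+ m)%R%:E).

End Laws.

(* Main.v *)
Require Import Defs.
From HB Require Import structures.
From mathcomp Require Import all_boot all_order all_algebra.
From mathcomp Require Import all_classical all_reals all_analysis.
From mathcomp Require Import measurable_realfun zify ring lra.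

Set Implicit Arguments.
Unset Strict Implicit.
Unset Printing Implicit Defensive.

Import Order.TTheory GRing.Theory Num.Theory.
Import numFieldNormedType.Exports.

Local Open Scope classical_set_scope.
Local Open Scope ring_scope.
Local Open Scope ereal_scope.

(** Only the [r - 1] gaps between consecutive runs separate [W] from [Y], and
    the ignored trials carry no information, so [W] has the law of
    [Y + (r - 1) g].  Everything else is the binomial theorem, its falling
    factorial version, and the invariance of central moments under
    translation.

    To compare the laws, the probability of an event that depends on the first
    [n] trials is written as a finite weighted mean over 0-1 words of length
    [n] ([probability_trials]); this makes the laws of [W] and [Y] independent
    of the space that carries the trials.  A word whose run number [r + 1]
    ends at [n] factors uniquely as a word whose run number [r] ends at some
    [m], then [g] arbitrary letters, then a word whose first run ends exactly
    at its end.  Hence the waiting time law satisfies the convolution recursion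
    [run_pmfS], in which the gap only shifts the index, and induction on [r]
    gives the shift of the law ([run_pmf_gap]).

    The moments exist because the tail is geometric.  A word with no run before
    its end has a first block of [k] letters that is not all successes, and the
    rest has no run either; so the probability that no run occurs is multiplied
    by at most [1 - p ^ k] every [k] trials ([no_run_before_geometric]).
    Geometric bounds survive convolution, hence hold for every [r]
    ([run_pmf_geometric]), and survive multiplication by powers of [n], at the
    price of a larger ratio ([geometrically_bounded_exprM]).

    Expectations of functions of a variable with values in [nat] are series in
    its point masses ([integral_nat]), so equality of the laws transfers both
    integrability and expectation from [Y + (r - 1) g] to [W]. *)

(** * Waiting times along a fixed sequence of outcomes *)

Section RunTimes.
Local Open Scope nat_scope.

Lemma success_run_local x y k s n :
  (forall i, i < n -> x i = y i) -> success_run x k s n -> success_run y k s n.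
Proof.
move=> exy [skn xS]; split=> // i /[dup] /andP[_ /exy <-]; exact: xS.
Qed.

Lemma success_run_shift x k s n :
  success_run x k s (s + n) <-> success_run (fun i => x (s + i)) k 0 n.
Proof.
split=> -[kn xS]; split; try lia.
  by move=> i hi; apply: xS; lia.
move=> i hi; have -> : i = s + (i - s) by lia.
by apply: xS; lia.
Qed.

Lemma first_run_local x y k s n :
  (forall i, i < n -> x i = y i) -> first_run x k s n -> first_run y k s n.
Proof.
move=> exy [xn xm]; split; first exact: success_run_local xn.
move=> m mn ym; apply: (xm m mn); apply: success_run_local ym => i im.
by rewrite exy //; lia.
Qed.

(** Trials up to [s] do not matter once counting restarts there: this is what
    turns the last factor of a word into a word with a first run. *)
Lemma first_run_shift x k s n :
  first_run x k s (s + n) <-> first_run (fun i => x (s + i)) k 0 n.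
Proof.
split=> -[xn xm]; split.
- by have [+ _] := success_run_shift x k s n; apply.
- move=> m mn xsm; apply: (xm (s + m)); first by lia.
  by have [_ +] := success_run_shift x k s m; apply.
- by have [_ +] := success_run_shift x k s n; apply.
- move=> m mn xsm; have sm : s <= m by case: xsm; lia.
  apply: (xm (m - s)); first by lia.
  by have [+ _] := success_run_shift x k s (m - s); apply; rewrite subnKC.
Qed.

Lemma first_run_ge x k s n : first_run x k s n -> s + k <= n.
Proof. by case=> -[]. Qed.

Lemma first_run_inj x k s n n' :
  first_run x k s n -> first_run x k s n' -> n = n'.
Proof.
move=> [xn xm] [xn' xm'].
by case: (ltngtP n n') => // [/xm'|/xm].
Qed.

Lemma run_time1 x k g n : run_time x k g 1 n <-> first_run x k 0 n.
Proof.
split=> [H|]; last exact: run_time_first.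
inversion H => //.
by match goal with h : run_time _ _ _ 0 _ |- _ => inversion h end.
Qed.

Lemma run_timeS x k g r n : 0 < r ->
  run_time x k g r.+1 n <->
  exists m, run_time x k g r m /\ first_run x k (m + g) n.
Proof.
move=> r0; split=> [H|[m [xm xn]]]; last exact: run_time_next xm xn.
by inversion H; subst=> //; exists m.
Qed.

Lemma run_time_inj x k g r n n' :
  run_time x k g r n -> run_time x k g r n' -> n = n'.
Proof.
move=> H; elim: H n' => {r n} [n xn n' /run_time1|r m n xm IH xn n'].
  exact: first_run_inj.
have r0 : 0 < r by inversion xm.
move=> /(run_timeS _ _ _ _ r0)[m' [/IH <-]]; exact: first_run_inj.
Qed.

(** Completion of a run at trial [n] is decided by the first [n] outcomes, so
    its probability is a finite sum. *)
Lemma run_time_local x y k g r n :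
  (forall i, i < n -> x i = y i) -> run_time x k g r n -> run_time y k g r n.
Proof.
move=> + H; elim: H => {r n} [n xn|r m n xm IH xn] exy.
  exact/run_time_first/first_run_local/xn.
apply: (@run_time_next _ _ _ _ m); last exact: first_run_local xn.
by apply: IH => i im; apply: exy; have := first_run_ge xn; lia.
Qed.

End RunTimes.

(** * Weighted means over words of outcomes *)

Section TrialMean.
Context {R : realType} (p : R).
Local Open Scope ring_scope.

(** The expectation of [f] at the word of the first [N] outcomes; the recursion
    is on the first letter, so that words split under concatenation. *)
Fixpoint trial_mean (N : nat) (f : seq bool -> R) : R :=
  if N is N'.+1 then
    p * trial_mean N' (fun s => f (true :: s)) +
    (1 - p) * trial_mean N' (fun s => f (false :: s))
  else f [::].

Lemma eq_trial_mean N f h : (forall s, size s = N -> f s = h s) ->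
  trial_mean N f = trial_mean N h.
Proof.
elim: N f h => [|N IH] f h fh /=; first exact: fh.
by congr (_ * _ + _ * _); apply: IH => s sN; apply: fh; rewrite /= sN.
Qed.

Lemma trial_mean_cst N c : trial_mean N (fun=> c) = c.
Proof.
by elim: N => //= N ->; rewrite -mulrDl addrC subrK mul1r.
Qed.

Lemma trial_meanM N c f : trial_mean N (fun s => c * f s) = c * trial_mean N f.
Proof. by elim: N f => //= N IH f; rewrite !IH mulrDr !(mulrCA c). Qed.

Lemma trial_meanD N f h :
  trial_mean N (fun s => f s + h s) = trial_mean N f + trial_mean N h.
Proof. by elim: N f h => //= N IH f h; rewrite !IH !mulrDr addrACA. Qed.

Lemma trial_mean_sum N (r : seq nat) (F : nat -> seq bool -> R) :
  trial_mean N (fun s => \sum_(i <- r) F i s) =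
  \sum_(i <- r) trial_mean N (F i).
Proof.
elim: r => [|i r IH].
  rewrite big_nil -[RHS](trial_mean_cst N).
  by apply: eq_trial_mean => s _; rewrite big_nil.
rewrite big_cons -IH -trial_meanD.
by apply: eq_trial_mean => s _; rewrite big_cons.
Qed.

Lemma trial_mean_cat N M f :
  trial_mean (N + M) f =
  trial_mean N (fun s => trial_mean M (fun t => f (s ++ t))).
Proof. by elim: N f => //= N IH f; rewrite !IH. Qed.

(** Independence of the first [N] outcomes from the next [M]. *)
Lemma trial_mean_indep N M f h :
  trial_mean (N + M) (fun u => f (take N u) * h (drop N u)) =
  trial_mean N f * trial_mean M h.
Proof.
rewrite trial_mean_cat mulrC -trial_meanM; apply: eq_trial_mean => s sN.
rewrite mulrC -trial_meanM; apply: eq_trial_mean => t _.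
by rewrite take_size_cat // drop_size_cat.
Qed.

Hypothesis p01 : 0 <= p <= 1.

Lemma trial_mean_le N f h : (forall s, size s = N -> f s <= h s) ->
  trial_mean N f <= trial_mean N h.
Proof.
elim: N f h => [|N IH] f h fh /=; first exact: fh.
have /andP[p0 p1] := p01; rewrite -subr_ge0 in p1.
by apply: lerD; (apply: ler_wpM2l => //; apply: IH => s sN;
  apply: fh; rewrite /= sN).
Qed.

Lemma trial_mean_ge0 N f : (forall s, 0 <= f s) -> 0 <= trial_mean N f.
Proof. by move=> f0; rewrite -(trial_mean_cst N 0); apply: trial_mean_le. Qed.

End TrialMean.

(** * Events decided by finitely many Bernoulli trials *)

Section LawOfTrials.
Context {R : realType} {d : measure_display} {T : measurableType d}.
Variables (Q : probability T R) (p : R) (X : nat -> {RV Q >-> bool}).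
Hypotheses (p01 : (0 <= p <= 1)%R) (XB : bernoulli_trials p X).

Let outcomes n w := mkseq (X^~ w) n.

Lemma outcomesE s : [set w | outcomes (size s) w = s] =
  \bigcap_(i in [set` iota 0 (size s)]) (X i @^-1` [set nth false s i]).
Proof.
apply/seteqP; split=> w /=.
  move=> <- i /=; rewrite mem_iota size_mkseq /= => iN.
  by rewrite nth_mkseq.
move=> H; apply: (@eq_from_nth _ false); first by rewrite size_mkseq.
move=> i; rewrite size_mkseq => iN; rewrite nth_mkseq //.
by apply: H; rewrite /= mem_iota.
Qed.

Lemma measurable_outcomes s : measurable [set w | outcomes (size s) w = s].
Proof.
rewrite outcomesE.
apply: fin_bigcap_measurable => [|i _]; first exact: finite_seq.
exact: measurable_funPTI.
Qed.

Lemma probability_outcomes s :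
  Q [set w | outcomes (size s) w = s] =
  (\prod_(b <- s) bernoulli_pmf p b)%R%:E.
Proof.
have [ind law] := XB.
rewrite outcomesE ind ?iota_uniq // -prodEFin.
rewrite [in RHS](big_nth false) /index_iota subn0.
apply: eq_bigr => i _.
rewrite -[LHS]/(distribution Q (X i) [set nth false s i]) law.
by rewrite /bernoulli_prob p01 fsbig_set1.
Qed.

(** The prefix [s] is what makes the induction go through: mutual independence
    gives the probability of a full word, and each step of the induction fixes
    one more letter. *)
Lemma outcomes_cylinder N s (A : set (seq bool)) :
  measurable [set w | outcomes (size s) w = s /\ A (outcomes (size s + N) w)] /\
  Q [set w | outcomes (size s) w = s /\ A (outcomes (size s + N) w)] =
  (\prod_(b <- s) bernoulli_pmf p b *
   trial_mean p N (fun t => \1_A (s ++ t)))%R%:E.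
Proof.
elim: N s => [|N IH] s.
  rewrite addn0 /= cats0 indicE.
  have [As|nAs] := pselect (A s).
    rewrite mem_set // mulr1 -probability_outcomes.
    set E := [set w | _].
    suff -> : E = [set w | outcomes (size s) w = s].
      by split=> //; exact: measurable_outcomes.
    by apply/seteqP; split=> w /= => [[]|ws] //; split; rewrite ?ws.
  rewrite memNset // mulr0.
  set E := [set w | _].
  suff -> : E = set0 by rewrite measure0.
  by apply/seteqP; split=> w //= [->].
have [mt Qt] := IH (rcons s true).
have [mf Qf] := IH (rcons s false).
set E := [set w | _].
set Et := [set w | _] in mt Qt; set Ef := [set w | _] in mf Qf.
have sz w b : outcomes (size (rcons s b)) w = rcons s b <->
    outcomes (size s) w = s /\ X (size s) w = b.
  rewrite size_rcons /outcomes mkseqS; split=> [/eqP|[-> ->]] //.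
  by rewrite eqseq_rcons => /andP[/eqP -> /eqP ->].
have szN b : (size (rcons s b) + N = size s + N.+1)%N.
  by rewrite size_rcons addSnnS.
have EU : E = Et `|` Ef.
  apply/seteqP; split=> w; rewrite /E /Et /Ef /= !szN !sz.
    by move=> [es Aw]; case: (X (size s) w); [left|right].
  by move=> [] [[]].
have dis : Et `&` Ef = set0.
  apply/seteqP; split=> w //; rewrite /Et /Ef /= !sz.
  by move=> [[[_ ->] _] [[]]].
rewrite EU; split; first exact: measurableU.
have -> : Q (Et `|` Ef) = Q Et + Q Ef by rewrite measureU.
rewrite Qt Qf -EFinD; congr EFin.
rewrite -!cats1 !big_cat !big_seq1 /= [in RHS]mulrDr !mulrA !cats1.
by congr (_ * _ + _ * _)%R; apply: eq_trial_mean => t _; rewrite cat_rcons.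
Qed.

Lemma probability_trials N (A : set (seq bool)) :
  Q [set w | A (mkseq (X^~ w) N)] = (trial_mean p N \1_A)%:E.
Proof.
have [_] := outcomes_cylinder N [::] A.
rewrite big_nil mul1r add0n => <-; congr (Q _).
by apply/seteqP; split=> w //= -[].
Qed.

End LawOfTrials.

(** * The law of the waiting time and the effect of the gap *)

Section RunTimeLaw.
Context {R : realType} (p : R) (k : nat).
Hypothesis p01 : (0 <= p <= 1)%R.
Local Open Scope ring_scope.

Definition run_pmf (g r n : nat) : R :=
  trial_mean p n \1_[set s | run_time (nth false s) k g r n].

Lemma probability_run_time {d} {T : measurableType d} (Q : probability T R)
    (X : nat -> {RV Q >-> bool}) g r n :
  bernoulli_trials p X ->
  Q [set w | run_time (X^~ w) k g r n] = (run_pmf g r n)%:E.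
Proof.
move=> XB; rewrite -(probability_trials p01 XB); congr (Q _).
by apply/seteqP; split=> w /=; apply: run_time_local => i iN;
  rewrite nth_mkseq.
Qed.

Lemma run_pmf_ge0 g r n : 0 <= run_pmf g r n.
Proof. by apply: trial_mean_ge0 => // s; rewrite indicE ler0n. Qed.

Lemma run_pmf1_gap g n : run_pmf g 1 n = run_pmf 0 1 n.
Proof.
rewrite /run_pmf; congr (trial_mean p n \1__).
by apply/seteqP; split=> s /=; rewrite !run_time1.
Qed.

(** The unique factorization of a word at the end [m] of its run number [r] and
    at the end [m + g] of the following gap.  The truncated bound [n.+1 - g]
    leaves no index when [n < g]. *)
Lemma indic_run_timeS g r n s : (0 < r)%N -> size s = n ->
  \1_[set s | run_time (nth false s) k g r.+1 n] s =
  \sum_(0 <= m < n.+1 - g)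
    \1_[set s | run_time (nth false s) k g r m] (take m s) *
    \1_[set s | run_time (nth false s) k 0 1 (n - g - m)] (drop g (drop m s))
  :> R.
Proof.
move=> r0 sn; pose x := nth false s.
(* Each product of indicators tells whether [m] is the end of run [r]. *)
have E m : (m < n.+1 - g)%N ->
    \1_[set s | run_time (nth false s) k g r m] (take m s) *
    \1_[set s | run_time (nth false s) k 0 1 (n - g - m)] (drop g (drop m s)) =
    (`[< run_time x k g r m /\ first_run x k (m + g) n >])%:R :> R.
  move=> mn; rewrite !indicE -natrM mulnb; congr (nat_of_bool _)%:R.
  apply/andP/asboolP; rewrite !inE /=.
    move=> [tm /run_time1 fm]; split.
      by apply: run_time_local tm => i im; rewrite nth_take.
    have -> : n = (m + g + (n - g - m))%N by lia.
    apply/first_run_shift; apply: first_run_local fm => i im.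
    by rewrite !nth_drop addnA.
  move=> [tm fm]; split.
    by apply: run_time_local tm => i im; rewrite nth_take.
  apply/run_time1; move: fm.
  rewrite {1}(_ : n = (m + g + (n - g - m)))%N; last by lia.
  move/first_run_shift; apply: first_run_local => i im.
  by rewrite !nth_drop addnA.
rewrite (eq_big_nat _ _ (F2 := fun m =>
  (`[< run_time x k g r m /\ first_run x k (m + g) n >])%:R)); last first.
  by move=> m /andP[_]; exact: E.
rewrite indicE; have [|nr] := pselect (run_time x k g r.+1 n); last first.
  rewrite memNset // big_nat big1 // => m _; case: asboolP => // mx.
  by case: nr; apply/(run_timeS _ _ _ _ r0); exists m.
move=> rn; rewrite mem_set //.
have /(run_timeS _ _ _ _ r0)[m [xm fm]] := rn.
have mn : (m < n.+1 - g)%N by have := first_run_ge fm; lia.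
rewrite (big_rem m) /=; last by rewrite mem_index_iota.
rewrite asboolT // big_seq big1 ?addr0 // => m'.
rewrite mem_rem_uniq ?iota_uniq // inE => /andP[/eqP mm' _].
by case: asboolP => // -[xm' _]; case: mm'; exact: run_time_inj xm' xm.
Qed.

(** The three factors of a word are independent, and the ignored letters have
    total weight 1. *)
Lemma run_pmfS g r n : (0 < r)%N ->
  run_pmf g r.+1 n =
  \sum_(0 <= m < n.+1 - g) run_pmf g r m * run_pmf 0 1 (n - g - m).
Proof.
move=> r0.
rewrite [LHS](eq_trial_mean _ (fun s => @indic_run_timeS g r n s r0)).
rewrite trial_mean_sum; apply: eq_big_nat => m /andP[_ mn].
have {1}-> : n = (m + (g + (n - g - m)))%N by lia.
rewrite (trial_mean_indep _ _ _ \1_[set s | run_time (nth false s) k g r m]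
  (fun s => \1_[set s | run_time (nth false s) k 0 1 (n - g - m)] (drop g s))).
(* The [g] letters of the gap contribute the mean of the constant 1. *)
congr (_ * _); rewrite -[RHS]mul1r -(trial_mean_cst p g 1) -trial_mean_indep.
by apply: eq_trial_mean => s _; rewrite mul1r.
Qed.

(** Each step of the recursion delays the index by [g], and there are [r - 1]
    steps; the first run is preceded by no gap. *)
Lemma run_pmf_gap g r n : (0 < r)%N ->
  run_pmf g r n =
  if ((r - 1) * g <= n)%N then run_pmf 0 r (n - (r - 1) * g) else 0.
Proof.
case: r => // r _; rewrite subn1 /=.
elim: r n => [|r IH] n; first by rewrite mul0n subn0 run_pmf1_gap.
rewrite !run_pmfS // !subn0 mulSn.
set c := (r * g)%N in IH *.
have small m : (m < c)%N -> run_pmf g r.+1 m = 0.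
  by move=> mc; rewrite IH leqNgt mc.
case: leqP => cn; last first.
  rewrite big_nat big1 // => m /andP[_ mn]; rewrite small ?mul0r //; lia.
(* The terms below [c] vanish by induction; the others are reindexed by [c]. *)
rewrite (big_cat_nat (n := c)) //=; last by lia.
rewrite [X in X + _]big_nat big1 ?add0r; last first.
  by move=> m /andP[_ mc]; rewrite small ?mul0r.
rewrite -{1}[c]add0n big_addn.
have -> : (n.+1 - g - c = (n - (g + c)).+1)%N by lia.
apply: eq_big_nat => m _; rewrite IH leq_addl addnK.
by congr (_ * run_pmf 0 1 _); lia.
Qed.

End RunTimeLaw.

(** * Sequences with a geometric upper bound *)

Section GeometricBounds.
Context {R : realType}.
Local Open Scope ring_scope.

Definition geometrically_bounded (u : nat -> R) : Prop :=
  exists C rho : R, [/\ 0 < C, 0 < rho < 1 & forall n, u n <= C * rho ^+ n].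

Lemma bernoulli_ineq (x : R) n : -1 <= x -> 1 + n%:R * x <= (1 + x) ^+ n.
Proof.
move=> x1; have x1' : 0 <= 1 + x by lra.
elim: n => [|n IH]; first by rewrite mul0r addr0 expr0.
rewrite exprS; apply: le_trans (ler_wpM2l x1' IH).
have nx : 0 <= n%:R * (x * x) :> R by rewrite mulr_ge0 // -expr2 sqr_ge0.
by rewrite -natr1; lra.
Qed.

Lemma geometrically_bounded_le u v :
  (forall n, u n <= v n) -> geometrically_bounded v -> geometrically_bounded u.
Proof.
move=> uv [C [rho [C0 rho01 vC]]]; exists C, rho; split=> // n.
exact: le_trans (uv n) (vC n).
Qed.

(** A linear factor is absorbed by any ratio [sigma] above [rho]: with
    [sigma = (1 + x) rho], the Bernoulli inequality gives [n x <= (1 + x) ^ n],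
    whence the constant [1 + x^-1]. *)
Lemma geometrically_bounded_linear (C rho : R) : 0 < C -> 0 < rho < 1 ->
  geometrically_bounded (fun n => n.+1%:R * (C * rho ^+ n)).
Proof.
move=> C0 /andP[r0 r1]; pose sigma := (1 + rho) / 2.
have [s0 s1 rs] : [/\ 0 < sigma, sigma < 1 & rho < sigma].
  by rewrite /sigma; split; lra.
pose x := sigma / rho - 1.
have x0 : 0 < x by rewrite /x subr_gt0 ltr_pdivlMr // mul1r.
exists (C * (1 + x^-1)), sigma; split; rewrite ?s0 ?s1 //.
  by rewrite mulr_gt0 // addr_gt0 // invr_gt0.
move=> n.
have -> : sigma = (1 + x) * rho by rewrite /x addrC subrK divfK // gt_eqF.
rewrite exprMn mulrCA -!mulrA ler_pM2l // (mulrA _ _ (rho ^+ n)).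
rewrite ler_pM2r ?exprn_gt0 //.
have x1 : -1 <= x by lra.
have B := @bernoulli_ineq x n x1.
have B1 : 1 <= (1 + x) ^+ n.
  by apply: le_trans B; rewrite lerDl mulr_ge0 // ltW.
have B2 : n%:R <= x^-1 * (1 + x) ^+ n.
  by rewrite mulrC ler_pdivlMr //; apply: le_trans B; rewrite lerDr.
by rewrite -natr1 mulrDl mul1r addrC lerD.
Qed.

Lemma geometrically_bounded_exprM u j : (forall n, 0 <= u n) ->
  geometrically_bounded u -> geometrically_bounded (fun n => n%:R ^+ j * u n).
Proof.
move=> u0; elim: j => [|j IH] ub.
  by apply: geometrically_bounded_le ub => n; rewrite expr0 mul1r.
have [C [rho [C0 rho01 uC]]] := IH ub.
apply: geometrically_bounded_le (geometrically_bounded_linear C0 rho01) => n.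
rewrite exprS -mulrA; apply: ler_pM => //; last by rewrite ler_nat.
by rewrite mulr_ge0 // exprn_ge0.
Qed.

(** With a common ratio the [n + 1] terms of the convolution have the same
    bound, which costs only a linear factor. *)
Lemma geometrically_bounded_conv u v :
  (forall n, 0 <= u n) -> (forall n, 0 <= v n) ->
  geometrically_bounded u -> geometrically_bounded v ->
  geometrically_bounded (fun n => \sum_(0 <= m < n.+1) u m * v (n - m)%N).
Proof.
move=> u0 v0 [C [rho [C0 /andP[r0 r1] uC]]] [D [tau [D0 /andP[t0 t1] vD]]].
pose s := Num.max rho tau.
have rs : rho <= s by rewrite le_max lexx.
have ts : tau <= s by rewrite le_max lexx orbT.
have s0 : 0 < s by rewrite lt_max r0.
have s1 : s < 1 by rewrite gt_max r1.
have s01 : 0 < s < 1 by rewrite s0.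
apply: geometrically_bounded_le
  (geometrically_bounded_linear (mulr_gt0 C0 D0) s01) => n.
rewrite -[n.+1]subn0 mulr_natl -sumr_const_nat.
apply: ler_sum_nat => m /andP[_ mn].
have -> : C * D * s ^+ n = (C * s ^+ m) * (D * s ^+ (n - m)).
  by rewrite mulrACA -exprD subnKC.
apply: ler_pM => //.
  apply: le_trans (uC m) _; rewrite ler_pM2l //.
  by apply: lerXn2r; rewrite ?nnegrE //; exact: ltW.
apply: le_trans (vD _) _; rewrite ler_pM2l //.
by apply: lerXn2r; rewrite ?nnegrE //; exact: ltW.
Qed.

(** The natural ratio is the [k]-th root of [1 - q]; to avoid roots, the proof
    takes [rho = 1 - q / (2 k)], for which the Bernoulli inequality gives
    [1 - q <= rho ^ k].  The argument [n.+1] exempts the index [k] from the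
    contraction hypothesis, which fails there for [no_run_before] below: no
    run can end before trial [k]. *)
Lemma geometrically_bounded_step (u : nat -> R) (k : nat) (q : R) :
  (0 < k)%N -> 0 < q <= 1 -> (forall n, u n <= 1) ->
  (forall n, u (k + n.+1)%N <= (1 - q) * u n.+1) -> geometrically_bounded u.
Proof.
move=> k0 /andP[q0 q1] u1 uk.
have kR : 0 < k%:R :> R by rewrite ltr0n.
have k1 : 1 <= k%:R :> R by rewrite ler1n.
pose rho := 1 - q / (k%:R * 2).
have qk : 0 < q / (k%:R * 2) by rewrite divr_gt0 // mulr_gt0.
have qk1 : q / (k%:R * 2) < 1 by rewrite ltr_pdivrMr ?mulr_gt0 //; lra.
have [r0 r1] : 0 < rho /\ rho < 1 by rewrite /rho; split; lra.
have rk : 1 - q <= rho ^+ k.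
  have : -1 <= - (q / (k%:R * 2)) by lra.
  move=> /(bernoulli_ineq k); apply: le_trans.
  have -> : k%:R * - (q / (k%:R * 2)) = - (q / 2) by field; rewrite gt_eqF.
  by lra.
exists (rho ^- k), rho; split; rewrite ?r0 ?r1 // ?invr_gt0 ?exprn_gt0 // => n.
elim/ltn_ind: n => n IH; case: (leqP n k) => [nk|kn].
  apply: le_trans (u1 n) _; rewrite mulrC ler_pdivlMr ?exprn_gt0 // mul1r.
  rewrite -(subnKC nk) exprD; apply: ler_piMr; first exact/exprn_ge0/ltW.
  by apply: exprn_ile1; exact: ltW.
have -> : n = (k + (n - k).-1.+1)%N by lia.
set m := (n - k).-1 in IH *.
apply: le_trans (uk m) _; rewrite exprD mulrCA.
apply: le_trans (ler_wpM2l _ (IH m.+1 _)) _; [lra|lia|].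
rewrite ler_wpM2r // mulr_ge0 ?invr_ge0 ?exprn_ge0 // ltW //.
Qed.

Lemma geometrically_bounded_summable (u : nat -> R) : (forall n, 0 <= u n) ->
  geometrically_bounded u -> (\sum_(0 <= n <oo) (u n)%:E < +oo)%E.
Proof.
move=> u0 [C [rho [C0 /andP[r0 r1] uC]]].
apply: (@le_lt_trans _ _ (C / (1 - rho))%:E); last exact: ltry.
apply: lime_le; first by apply: is_cvg_nneseries => n _ _; rewrite lee_fin.
apply: nearW => n; rewrite sumEFin lee_fin.
apply: le_trans (geometric_le_lim n (ltW C0) r0 _); last first.
  by rewrite ger0_norm ?ltW.
by apply: ler_sum => m _; exact: uC.
Qed.

End GeometricBounds.

(** * Geometric tail of the waiting time *)

Section RunTail.
Context {R : realType} (p : R) (k : nat).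
Hypotheses (p01 : (0 < p < 1)%R) (k0 : (0 < k)%N).
Local Open Scope ring_scope.

Let p01' : 0 <= p <= 1.
Proof. by case/andP: p01 => /ltW -> /ltW ->. Qed.

Definition no_run_before n : set (seq bool) :=
  [set s | forall m, (m < n)%N -> ~ success_run (nth false s) k 0 m].

Lemma trial_mean_all_success N :
  trial_mean p N (fun s => (all id s)%:R) = p ^+ N.
Proof.
elim: N => [|N IH] //=; rewrite IH trial_mean_cst mulr0 addr0 -exprS //.
Qed.

(** If no run ends before the end of a word, its first [k] letters are not all
    successes and the word that follows has the same property; the two parts
    are independent. *)
Lemma no_run_before_geometric :
  geometrically_bounded (fun n => trial_mean p n \1_(no_run_before n)).
Proof.
have /andP[p0 p1] := p01.
apply: (@geometrically_bounded_step _ _ k (p ^+ k)) => //.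
- by rewrite exprn_gt0 // exprn_ile1 // ltW.
- move=> n; rewrite -[leRHS](trial_mean_cst p n).
  by apply: trial_mean_le => // s _; rewrite indicE; case: (_ \in _).
move=> n.
rewrite -trial_mean_all_success -[X in X - _](trial_mean_cst p k).
have -> : trial_mean p k (fun=> 1) -
    trial_mean p k (fun s => (all id s)%:R) =
    trial_mean p k (fun s => (~~ all id s)%:R).
  apply/eqP; rewrite subr_eq -trial_meanD; apply/eqP.
  by apply: eq_trial_mean => s _; case: (all _ _); rewrite ?addr0 ?add0r.
rewrite -trial_mean_indep; apply: trial_mean_le => // s sN.
rewrite !indicE -natrM mulnb ler_nat.
have [|//] := boolP (s \in _); rewrite inE /= => nr.
have -> : ~~ all id (take k s).
  apply/negP => /(all_nthP false) a; apply: (nr k); first by lia.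
  split=> [//|i]; rewrite subnn /= => ik; rewrite -(nth_take _ ik).
  by apply: a; rewrite size_takel // sN leq_addr.
rewrite mem_set //= => m mn rm; apply: (nr (k + m)%N); first by lia.
have [_ shift] := success_run_shift (nth false s) k k m.
have /shift[km sm] : success_run (fun i => nth false s (k + i)) k 0 m.
  by apply: success_run_local rm => i im; rewrite nth_drop.
by split=> //; lia.
Qed.

(** Waiting exactly [n] trials for the first run means that none ended before;
    later runs follow by convolution. *)
Lemma run_pmf_geometric r : (0 < r)%N ->
  geometrically_bounded (run_pmf p k 0 r).
Proof.
have b1 : geometrically_bounded (run_pmf p k 0 1).
  apply: geometrically_bounded_le no_run_before_geometric => n.
  apply: trial_mean_le => // s sn; rewrite !indicE ler_nat.
  have [|//] := boolP (s \in _); rewrite inE /= => /run_time1[_ nr].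
  by rewrite mem_set.
case: r => // r _; elim: r => // r IH.
apply: geometrically_bounded_le (geometrically_bounded_conv _ _ IH b1) => n.
- by rewrite run_pmfS // !subn0.
- exact: run_pmf_ge0.
- exact: run_pmf_ge0.
Qed.

End RunTail.

(** * Expectations of functions of a variable with values in [nat] *)

Section DiscreteLaw.
Context {R : realType} {d : measure_display} {T : measurableType d}.
Variables (P : probability T R) (Z : T -> nat).
Hypothesis mZ : measurable_fun setT Z.

Lemma measurable_nat_comp (f : nat -> R) :
  measurable_fun [set: T] (EFin \o (f \o Z)).
Proof.
by apply/measurable_EFinP; apply: (measurableT_comp (f := f)).
Qed.

Let Zn n := [set w | Z w = n].

Let mZn n : measurable (Zn n).
Proof. by rewrite -[Zn n]setTI; exact: (mZ measurableT (Y := [set n])). Qed.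

Let trivZ : trivIset setT Zn.
Proof. by move=> i j _ _ [w [<- <-]]. Qed.

Let cupZ : \bigcup_n Zn n = setT.
Proof. by apply/seteqP; split=> // w _; exists (Z w). Qed.

Let integral_Zn (f : nat -> R) n :
  \int[P]_(w in Zn n) (f (Z w))%:E = (f n)%:E * P (Zn n).
Proof.
rewrite -integral_cst //; apply: eq_integral => w.
by rewrite inE => ->.
Qed.

Lemma ge0_integral_nat (f : nat -> R) : (forall n, 0 <= f n)%R ->
  \int[P]_w (f (Z w))%:E = \sum_(0 <= n <oo) (f n)%:E * P (Zn n).
Proof.
move=> f0; rewrite -[in LHS]cupZ ge0_integral_bigcup //.
- by apply: eq_eseriesr => n _; exact: integral_Zn.
- by rewrite cupZ; exact: measurable_nat_comp.
- by move=> w _; rewrite lee_fin.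
Qed.

Lemma integral_nat (f : nat -> R) :
  P.-integrable setT (fun w => (f (Z w))%:E) ->
  \int[P]_w (f (Z w))%:E = \sum_(0 <= n <oo) (f n)%:E * P (Zn n).
Proof.
move=> fi; rewrite -[in LHS]cupZ integral_bigcup ?cupZ //.
by apply: eq_eseriesr => n _; exact: integral_Zn.
Qed.

Lemma integrable_nat (f : nat -> R) :
  P.-integrable setT (fun w => (f (Z w))%:E) <->
  \sum_(0 <= n <oo) (`|f n|%R)%:E * P (Zn n) < +oo.
Proof.
rewrite -(@ge0_integral_nat (fun n => `|f n|%R)) //.
split=> [/integrableP[_]//|fi]; apply/integrableP; split=> //.
exact: measurable_nat_comp.
Qed.

End DiscreteLaw.

Section SameLaw.
Context {R : realType} {d1 d2 : measure_display}.
Context {T1 : measurableType d1} {T2 : measurableType d2}.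
Variables (P1 : probability T1 R) (P2 : probability T2 R).
Variables (Z1 : T1 -> nat) (Z2 : T2 -> nat).
Hypotheses (m1 : measurable_fun setT Z1) (m2 : measurable_fun setT Z2).
Hypothesis same_law : forall n, P1 [set w | Z1 w = n] = P2 [set w | Z2 w = n].

Lemma same_law_integrable (f : nat -> R) :
  P2.-integrable setT (fun w => (f (Z2 w))%:E) ->
  P1.-integrable setT (fun w => (f (Z1 w))%:E).
Proof.
move=> /(integrable_nat _ m2) H; apply/(integrable_nat _ m1).
by under eq_eseriesr do rewrite same_law.
Qed.

Lemma same_law_expectation (f : nat -> R) :
  P2.-integrable setT (fun w => (f (Z2 w))%:E) ->
  'E_P1[fun w => f (Z1 w)] = 'E_P2[fun w => f (Z2 w)].
Proof.
move=> H; rewrite unlock !integral_nat //; last exact: same_law_integrable.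
by apply: eq_eseriesr => n _; rewrite same_law.
Qed.

End SameLaw.

(** * Moments of a translate *)

(** The binomial theorem for falling factorials: the Vandermonde convolution
    multiplied by [n`!]. *)
Lemma ffactnD x c n :
  ((x + c) ^_ n = \sum_(0 <= i < n.+1) 'C(n, i) * x ^_ (n - i) * c ^_ i)%N.
Proof.
rewrite -bin_ffact addnC -binomial.Vandermonde big_distrl /= big_mkord.
apply: eq_bigr => i _; have ni : (i <= n)%N by rewrite -ltnS.
rewrite -(bin_fact ni) -!bin_ffact.
(* The binomials are made atoms, so that only commutativity remains. *)
set a := 'C(c, i); set b := 'C(x, _); set e := 'C(n, i).
by rewrite -!mulnA; lia.
Qed.

Lemma ffact_le_exp x n : (x ^_ n <= x ^ n)%N.
Proof.
elim: n => // n IH; rewrite ffactnSr expnSr leq_mul //; exact: leq_subr.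
Qed.

Section ShiftedMoments.
Context {R : realType} {d : measure_display} {T : measurableType d}.
Variables (P : probability T R) (Y : T -> nat).
Hypothesis mY : measurable_fun setT Y.

Lemma expectation_sum_scaled (n : nat) (h : nat -> nat -> R) (b e : nat -> R) :
  (forall j, P.-integrable setT (fun w => (h j (Y w))%:E)) ->
  P.-integrable setT
    (fun w => (\sum_(0 <= i < n.+1) b i * h (n - i)%N (Y w) * e i)%R%:E) /\
  'E_P[fun w => (\sum_(0 <= i < n.+1) b i * h (n - i)%N (Y w) * e i)%R] =
  \sum_(0 <= i < n.+1) (b i)%:E * 'E_P[fun w => h (n - i)%N (Y w)] * (e i)%:E.
Proof.
move=> hi.
have bhi i : P.-integrable setT (fun w => (b i)%:E * (h (n - i)%N (Y w))%:E).
  exact: integrableZl.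
have hbe i : P.-integrable setT
    (fun w => (b i)%:E * (h (n - i)%N (Y w))%:E * (e i)%:E).
  exact: integrableZr.
have E : (fun w => (\sum_(0 <= i < n.+1) b i * h (n - i)%N (Y w) * e i)%R%:E) =
    (fun w => \sum_(0 <= i < n.+1)
      (b i)%:E * (h (n - i)%N (Y w))%:E * (e i)%:E).
  by apply/funext => w; rewrite -sumEFin.
split; first by rewrite E; exact: integrable_sum.
rewrite unlock E integral_sum //; apply: eq_bigr => i _.
by rewrite integralZr // integralZl.
Qed.

Hypothesis Yi : forall j, P.-integrable setT (fun w => ((Y w)%:R ^+ j)%R%:E).

Lemma integrable_ffact j : P.-integrable setT (fun w => ((Y w ^_ j)%:R)%R%:E).
Proof.
apply: le_integrable (Yi j) => //.
  exact: (measurable_nat_comp mY (fun m => (m ^_ j)%:R%R)).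
move=> w _; rewrite !abse_EFin lee_fin !ger0_norm ?exprn_ge0 ?ler0n //.
by rewrite -natrX ler_nat ffact_le_exp.
Qed.

Lemma shifted_power a n :
  P.-integrable setT (fun w => (((Y w)%:R + a) ^+ n)%R%:E) /\
  'E_P[fun w => (((Y w)%:R + a) ^+ n)%R] =
  \sum_(0 <= i < n.+1) ('C(n, i)%:R)%:E *
    'E_P[fun w => ((Y w)%:R ^+ (n - i))%R] * (a ^+ i)%:E.
Proof.
have E w : (((Y w)%:R + a) ^+ n =
    \sum_(0 <= i < n.+1) 'C(n, i)%:R * (Y w)%:R ^+ (n - i) * a ^+ i)%R.
  rewrite exprDn big_mkord; apply: eq_bigr => i _.
  by rewrite -mulr_natl mulrA.
have [intS ES] := @expectation_sum_scaled n (fun j m => m%:R ^+ j)%R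
  (fun i => 'C(n, i)%:R)%R (fun i => a ^+ i)%R Yi.
by split; [under eq_fun do rewrite E|rewrite (funext E)].
Qed.

Lemma shifted_ffact c n :
  P.-integrable setT (fun w => (((Y w + c) ^_ n)%:R)%R%:E) /\
  'E_P[fun w => (((Y w + c) ^_ n)%:R)%R] =
  \sum_(0 <= i < n.+1) ('C(n, i)%:R)%:E *
    'E_P[fun w => ((Y w ^_ (n - i))%:R)%R] * ((c ^_ i)%:R)%:E.
Proof.
have E w : ((((Y w + c) ^_ n)%:R : R) =
    \sum_(0 <= i < n.+1) 'C(n, i)%:R * (Y w ^_ (n - i))%:R * (c ^_ i)%:R)%R.
  by rewrite ffactnD natr_sum; apply: eq_bigr => i _; rewrite !natrM.
have [intS ES] := @expectation_sum_scaled n (fun j m => (m ^_ j)%:R)%R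
  (fun i => 'C(n, i)%:R)%R (fun i => (c ^_ i)%:R)%R integrable_ffact.
by split; [under eq_fun do rewrite E|rewrite (funext E)].
Qed.

End ShiftedMoments.

(** * The moments of the waiting time with gaps *)

Theorem mainTheorem8 (R : realType) (k r g : nat) (p : R)
    (hk : (1 <= k)%N) (hr : (1 <= r)%N) (hg : (1 <= g)%N)
    (hp : (0 < p < 1)%R)
    (d1 : measure_display) (T1 : measurableType d1) (P1 : probability T1 R)
    (W : {RV P1 >-> nat}) (hW : has_NB_gap_law k r g p W)
    (d2 : measure_display) (T2 : measurableType d2) (P2 : probability T2 R)
    (Y : {RV P2 >-> nat}) (hY : has_NB_typeI_law k r p Y)
    (n : nat) (hn : (1 <= n)%N) :
  (finite_moment W n /\ finite_moment Y n) /\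
  [/\ factorial_moment W n =
        \sum_(0 <= i < n.+1) ('C(n, i)%:R)%:E * factorial_moment Y (n - i)
          * ((((r - 1) * g) ^_ i)%:R)%:E,
      raw_moment W n =
        \sum_(0 <= i < n.+1) ('C(n, i)%:R)%:E * raw_moment Y (n - i)
          * ((((r - 1) * g) ^ i)%:R)%:E
    & central_moment W n = central_moment Y n].
Proof.
have p01 : (0 <= p <= 1)%R by case/andP: hp => /ltW -> /ltW ->.
set c := ((r - 1) * g)%N.
have lawW m : P1 [set w | W w = m] = (run_pmf p k g r m)%:E.
  by have [d' [T' [Q [X [XB ->]]]]] := hW; exact: probability_run_time.
have lawY m : P2 [set w | Y w = m] = (run_pmf p k 0 r m)%:E.
  by have [d' [T' [Q [X [XB ->]]]]] := hY; exact: probability_run_time.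
have mW : measurable_fun setT W by [].
have mY : measurable_fun setT Y by [].
(* [W] has the law of the translate [Yc] of [Y]. *)
pose Yc w := (Y w + c)%N.
have mYc : measurable_fun setT Yc.
  have mc : measurable_fun [set: nat] (fun m => m + c)%N by [].
  exact: measurableT_comp mc mY.
have same m : P1 [set w | W w = m] = P2 [set w | Yc w = m].
  rewrite lawW run_pmf_gap //; case: leqP => [cm|mc].
    by rewrite -lawY; congr (P2 _); apply/seteqP; split=> w /=;
      rewrite /Yc; lia.
  rewrite [X in P2 X](_ : _ = set0) ?measure0 //.
  by apply/seteqP; split=> // w /=; rewrite /Yc; lia.
have Yi j : P2.-integrable setT (fun w => ((Y w)%:R ^+ j)%R%:E).
  apply/(integrable_nat P2 mY (fun m => m%:R ^+ j)%R).
  under eq_eseriesr do rewrite lawY -EFinM ger0_norm ?exprn_ge0 //.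
  apply: geometrically_bounded_summable.
    by move=> m; rewrite mulr_ge0 ?exprn_ge0 ?run_pmf_ge0.
  apply: geometrically_bounded_exprM; first exact: run_pmf_ge0.
  exact: run_pmf_geometric.
have YcE w : ((Yc w)%:R = (Y w)%:R + c%:R :> R)%R by rewrite natrD.
have powYc j : P2.-integrable setT (fun w => ((Yc w)%:R ^+ j)%R%:E).
  have [+ _] := shifted_power Yi c%:R j.
  by under eq_fun do rewrite -YcE.
(* The case of exponent 1 in the binomial expansion. *)
have meanW : fine 'E_P1[fun w => ((W w)%:R)%R] =
    (fine 'E_P2[fun w => ((Y w)%:R)%R] + c%:R)%R.
  rewrite (same_law_expectation mW mYc same (f := fun m => m%:R%R)); last first.
    exact: powYc 1%N.
  have [_] := shifted_power Yi c%:R 1.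
  under eq_fun do rewrite -YcE expr1.
  move=> ->.
  rewrite !big_nat_recr //= big_nil add0e expr0 expr1 bin0 bin1 subn0 subnn.
  have -> : 'E_P2[fun w => ((Y w)%:R ^+ 0)%R] = 1 by exact: expectation_cst.
  rewrite !mul1e mule1 fineD //.
  by apply: expectation_fin_num; apply/Lfun1_integrable; exact: Yi 1%N.
split.
  split; last exact: Yi.
  apply: (same_law_integrable mW mYc same (f := fun m => (m%:R ^+ n)%R)).
  exact: powYc.
split.
- rewrite /factorial_moment.
  have [intf Ef] := shifted_ffact mY Yi c n.
  by rewrite (same_law_expectation mW mYc same (f := fun m => (m ^_ n)%:R%R)).
- rewrite /raw_moment.
  rewrite (same_law_expectation mW mYc same (f := fun m => (m%:R ^+ n)%R)) //.
  have [_] := shifted_power Yi c%:R n.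
  under eq_fun do rewrite -YcE.
  by move=> ->; apply: eq_bigr => i _; rewrite natrX.
rewrite /central_moment meanW; set mu := fine _.
have [intc Ec] := shifted_power Yi (- mu) n.
have shiftE w : ((Yc w)%:R - (mu + c%:R) = (Y w)%:R - mu)%R.
  by rewrite YcE; ring.
rewrite (same_law_expectation mW mYc same
  (f := fun m => ((m%:R - (mu + c%:R)) ^+ n)%R)).
  by congr ('E_P2[_]); apply/funext => w; rewrite shiftE.
by under eq_fun do rewrite shiftE.
Qed.
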